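(* Let $T$ be an ergodic automorphism with discrete spectrum, realized as an ergodic translation $Tx=x+g$ on a compact abelian group $G$ with normalized Haar measure $m$, and let $\rho$ be either a bounded admissible metric on $(G,m)$ or, more generally, an admissible metric for which the average metric $\hat\rho^T$ is admissible. Then the scaling sequence for $T$ and $\rho$ is bounded, i.e. for every $\varepsilon>0$ the sequence $n\mapsto H_{\hat\rho_n,\varepsilon}(m)$ is bounded.
   Context: $\hat\rho_n(x,y)=\frac1n\sum_{k=0}^{n-1}\rho(T^kx,T^ky)$ and $\hat\rho^T=\lim_n\hat\rho_n$ (a.e.). A measurable $\rho$ is an admissible metric if (1) it is a metric in the usual sense on a set of full measure and $\int\int\rho\,dm\,dm<\infty$, and (2) the completion of $(G,\rho)$ is a Polish space on which $m$ is a Borel probability measure (the Borel $\sigma$-algebra being dense mod $0$ in the measurable $\sigma$-algebra). For an admissible (semi)metric $\theta$, $H_{\theta,\varepsilon}(m)=\inf\{H(\nu):k_\theta(\nu,m)<\varepsilon\}$, where $\nu=\sum_ic_i\delta_{x_i}$ ranges over discrete measures with finite entropy $H(\nu)=-\sum_ic_i\ln c_i$ and $k_\theta$ is the Kantorovich (transportation) metric for the cost $\theta$. The class of scaling sequences for $T,\rho,\varepsilon$ is the set of increasing positive sequences $(c_n)$ with $0<\liminf_n H_{\hat\rho_n,\varepsilon}(m)/c_n\le\limsup_n H_{\hat\rho_n,\varepsilon}(m)/c_n<\infty$; ''the scaling sequence is bounded'' means these entropies stay bounded in $n$. *)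

(* Defs.v *)
From HB Require Import structures.
From mathcomp Require Import all_boot all_order all_algebra.
From mathcomp Require Import all_classical all_reals all_analysis.
Set Implicit Arguments. Unset Strict Implicit. Unset Printing Implicit Defensive.
Import Order.TTheory GRing.Theory Num.Theory numFieldNormedType.Exports.
Local Open Scope classical_set_scope.
Local Open Scope ring_scope.

Definition gpt (G : topologicalZmodType) : Type := G.
HB.instance Definition _ (G : topologicalZmodType) := Choice.on (gpt G).
HB.instance Definition _ (G : topologicalZmodType) :=
  isPointed.Build (gpt G) (GRing.zero : G).
Notation Borel G := (@g_sigma_algebraType (gpt G) (@open G)).

Section Defs.
Context {R : realType} {G : topologicalZmodType}.
Local Notation GB := (Borel G).

(* m is the normalized Haar measure: translation invariant, and (being a
   Radon measure) inner regular by compact sets. *)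
Definition haar (m : probability GB R) : Prop :=
  (forall (a : G) (A : set GB), measurable A ->
     m ((fun x : G => x + a) @` A) = m A) /\
  (forall A : set GB, measurable A ->
     m A = ereal_sup [set m (K : set GB) | K in [set K : set G | compact K /\ K `<=` A]]).

Definition transl (g : G) : G -> G := fun x => x + g.

Definition ergodic_translation (m : probability GB R) (g : G) : Prop :=
  forall A : set GB, measurable A -> transl g @^-1` A = A ->
    m A = 0%E \/ m A = 1%E.

Definition rho_hat (g : G) (rho : G -> G -> R) (n : nat) : G -> G -> R :=
  fun x y => n%:R^-1 * \sum_(k < n) rho (iter k (transl g) x) (iter k (transl g) y).

Definition is_metric_on (X : set G) (rho : G -> G -> R) : Prop :=
  (forall x y, X x -> X y -> (rho x y = 0 <-> x = y)) /\
  (forall x y, X x -> X y -> rho x y = rho y x) /\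
  (forall x y z, X x -> X y -> X z -> rho x z <= rho x y + rho y z).

Definition rho_balls (X : set G) (rho : G -> G -> R) : set (set G) :=
  [set B | exists x r, X x /\ 0 < r /\ B = [set y | X y /\ rho x y < r]].

(* Admissibility of rho, witnessed by the full-measure set X:
   (1) rho is measurable, a metric on X, m(X)=1, and int int |rho| dm dm < oo;
   (2) the completion of (X, rho) is Polish (equivalently (X, rho) is
       separable) and m is a Borel measure on it (rho-balls are measurable),
       the rho-Borel sigma-algebra being dense mod 0 in the measurable
       sigma-algebra. *)
Definition admissible_on (m : probability GB R) (rho : G -> G -> R) (X : set GB) : Prop :=
  [/\ measurable X, m X = 1%E,
      measurable_fun [set: GB * GB] (fun p : GB * GB => rho p.1 p.2),
      is_metric_on X rho &
      (\int[m]_x \int[m]_y (`|rho x y|)%:E < +oo)%E] /\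
  [/\ (exists d : nat -> G, (forall n, X (d n)) /\
         forall x, X x -> forall e, 0 < e -> exists n, rho x (d n) < e),
      (forall B, rho_balls X rho B -> measurable (B : set GB)) &
      (forall A : set GB, measurable A -> exists B : set GB,
          <<s rho_balls X rho >> B /\ measurable B /\
          m ((A `\` B) `|` (B `\` A)) = 0%E)].

Definition admissible (m : probability GB R) (rho : G -> G -> R) : Prop :=
  exists X, admissible_on m rho X.

Definition bounded_admissible (m : probability GB R) (rho : G -> G -> R) : Prop :=
  exists X C, admissible_on m rho X /\
    forall x y, X x -> X y -> rho x y <= C.

Definition average_limit (m : probability GB R) (g : G) (rho rhoT : G -> G -> R) : Prop :=
  {ae (m \x m)%E, forall p : GB * GB,
     ((fun n : nat => rho_hat g rho n.+1 p.1 p.2) : R^nat) @ \oo --> (rhoT p.1 p.2 : R)}.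

(* A discrete probability measure nu = sum_i c_i delta_{x_i} (distinct atoms) *)
Definition discrete_prob (x : nat -> G) (c : nat -> R) : Prop :=
  (forall i, 0 <= c i) /\
  (\sum_(0 <= i <oo) (c i)%:E = 1)%E /\
  (forall i j, 0 < c i -> 0 < c j -> x i = x j -> i = j).

Definition discrete_meas (x : nat -> G) (c : nat -> R) (A : set G) : \bar R :=
  (\sum_(0 <= i <oo) ((c i)%:E * (\1_A (x i))%:E))%E.

Definition entropy (c : nat -> R) : \bar R :=
  (\sum_(0 <= i <oo) (- (c i * ln (c i)))%:E)%E.

Definition coupling (nu : set G -> \bar R) (m : probability GB R)
  (gam : probability (GB * GB)%type R) : Prop :=
  forall A : set GB, measurable A ->
    gam (A `*` [set: GB]) = nu A /\ gam ([set: GB] `*` A) = m A.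

Definition kantorovich (theta : G -> G -> R) (nu : set G -> \bar R)
  (m : probability GB R) : \bar R :=
  ereal_inf [set (\int[gam]_p (theta p.1 p.2)%:E)%E
            | gam in [set gam | coupling nu m gam]].

Definition eps_entropy (theta : G -> G -> R) (eps : R) (m : probability GB R) : \bar R :=
  ereal_inf [set entropy c | c in
    [set c | exists x, discrete_prob x c /\ (entropy c < +oo)%E /\
             (kantorovich theta (discrete_meas x c) m < eps%:E)%E]].

End Defs.

(* Main.v *)
Require Import Defs.
From HB Require Import structures.
From mathcomp Require Import all_boot all_order all_algebra.
From mathcomp Require Import all_classical all_reals all_analysis.
From mathcomp Require Import measurable_realfun lra.
Import Order.TTheory GRing.Theory Num.Theory numFieldNormedType.Exports.
Local Open Scope classical_set_scope.
Local Open Scope ring_scope.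
Set Implicit Arguments.
Unset Strict Implicit.

(* Separability of rho, inner regularity of m and compactness show that rho is
   almost controlled by the topology: for every e > 0 there are a neighbourhood
   U of 0 and u >= 0 with integral at most e such that
     rho x y <= e + u x + u y    whenever x - y lies in U.
   The condition on x - y and the integral of u are translation invariant, so
   the same inequality holds for the averaged metric rho_hat n with u replaced
   by its orbit average u_n, whose integral is still at most e.  A finite
   partition of G into U-small cells, chosen independently of n, then
   discretizes m: move each cell to a point almost minimizing u_n in it.  The
   transport cost is at most the integral of 2 e + 2 u_n, and the entropy is at
   most the number of cells. *)

Lemma almost_minimizers (R : realType) (T : pointedType) (I : Type)
    (S : I -> set T) (u : T -> R) (e : R) :
  has_lbound (range u) -> 0 < e ->
  exists x : I -> T, forall i, S i !=set0 ->
    S i (x i) /\ forall y, S i y -> u (x i) <= u y + e.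
Proof.
move=> [b lb] e0; suff min_in i : exists xi : T, S i !=set0 ->
    S i xi /\ forall y, S i y -> u xi <= u y + e.
  by have [x] := choice min_in; exists x.
have [S0|] := pselect (S i !=set0); last by exists point.
have infS : has_inf (u @` S i).
  by split; [exact: image_nonempty|exists b => _ [y _ <-]; apply: lb; exists y].
have [_ [x Sx <-] lt_x] := inf_adherent e0 infS.
exists x => _; split => // y Sy; apply: le_trans (ltW lt_x) _.
by rewrite lerD2r; apply: (ge_inf infS.2); exists y.
Qed.

Definition excess (R : realType) (T : Type) (f : T -> R) (C : R) (x : T) : R :=
  Num.max (f x - C) 0.

Lemma excess_ge0 (R : realType) (T : Type) (f : T -> R) (C : R) x :
  0 <= excess f C x.
Proof. by rewrite le_max lexx orbT. Qed.

Lemma le_excess (R : realType) (T : Type) (f : T -> R) (C : R) x :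
  f x <= C + excess f C x.
Proof. by rewrite -lerBlDl le_max lexx. Qed.

Section measure_approximation.
Context d (T : measurableType d) (R : realType).
Implicit Types (mu : {measure set T -> \bar R}).

Lemma ae_exists mu (A : set T) (P : T -> Prop) :
  measurable A -> (0 < mu A)%E -> {ae mu, forall x, P x} ->
  exists2 x, A x & P x.
Proof.
move=> mA A_gt0 [N [mN N0 PN]]; apply: contrapT => noP.
have AN : A `<=` N by move=> x Ax; apply: PN => Px; apply: noP; exists x.
by move: A_gt0; rewrite (subset_measure0 mA mN AN N0) ltxx.
Qed.

Lemma measure_bigcup_approx (mu : {finite_measure set T -> \bar R})
    (B : nat -> set T) (e : R) :
  (forall j, measurable (B j)) -> 0 < e ->
  exists J, (mu (\bigcup_j B j) <= mu (\bigcup_(j < J) B j) + e%:E)%E.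
Proof.
move=> mB e0; pose F J := \bigcup_(j < J) B j.
have mF J : measurable (F J) by exact: bigcup_measurable.
have FE : \bigcup_J F J = \bigcup_j B j.
  apply/seteqP; split => [x [J _ [j _ Bx]]|x [j _ Bx]]; first by exists j.
  by exists j.+1 => //; exists j => //=.
have ndF : nondecreasing_seq F.
  move=> I J IJ; apply/subsetPset => x [j jI Bx].
  by exists j => //; exact: leq_trans jI IJ.
have mUF : measurable (\bigcup_J F J) by exact: bigcup_measurable.
have := @nondecreasing_cvg_mu _ _ _ mu F mF mUF ndF.
have lt_mu : (mu (\bigcup_J F J) - e%:E < mu (\bigcup_J F J))%E.
  by rewrite lteBlDr// lteDl ?fin_num_measure// lte_fin.
move=> /(_ [set y | (mu (\bigcup_J F J) - e%:E < y)%E]) [].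
  by apply: open_nbhs_nbhs; split; [exact: open_ereal_gt_ereal|].
by move=> J _ /(_ J (leqnn J)) /ltW; exists J; rewrite -leeBlDr// -FE.
Qed.

Lemma measurable_excess (f : T -> R) (C : R) :
  measurable_fun setT f -> measurable_fun setT (excess f C).
Proof. by move=> mf; apply: measurable_maxr => //; exact: measurable_funB. Qed.

Lemma integral_excess_small mu (f : T -> R) (e : R) :
  mu.-integrable setT (EFin \o f) -> 0 < e ->
  exists2 C : R, 0 <= C & (\int[mu]_x (excess f C x)%:E <= e%:E)%E.
Proof.
move=> intf e0; have /measurable_EFinP mf := measurable_int _ intf.
pose F (n : nat) x : \bar R := (excess f n%:R x)%:E.
have mF n : measurable_fun setT (F n).
  by apply/measurable_EFinP; exact: measurable_excess.
have F_cvg0 x : F n x @[n --> \oo] --> (cst 0%E : T -> \bar R) x.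
  apply: cvg_near_cst; exists (Num.trunc (f x)).+1 => // n /= le_n.
  rewrite /F /excess max_r// subr_le0; apply: le_trans (ltW (truncnS_gt _)) _.
  by rewrite ler_nat.
have F_le n x : (`|F n x| <= `|(EFin \o f) x|)%E.
  rewrite /F /= lee_fin ger0_norm ?excess_ge0// ge_max normr_ge0 andbT.
  by rewrite lerBlDr (le_trans (ler_norm _))// lerDl.
have := @dominated_cvg _ _ _ mu _ measurableT F (cst 0%E) (abse \o EFin \o f) mF
  (fun x _ => F_cvg0 x) (fun _ _ => isT) (integrable_abse intf)
  (fun n x _ => F_le n x).
rewrite integral0 => /(_ [set y | (y < e%:E)%E]) [].
  apply: open_nbhs_nbhs; split; first exact: open_ereal_lt_ereal.
  by rewrite /= lte_fin.
by move=> n _ /(_ n (leqnn n)) /ltW; exists n%:R.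
Qed.

End measure_approximation.

Section entropy.
Context {R : realType}.

Lemma entropy_term_ge0 (c : R) : 0 <= c <= 1 -> 0 <= - (c * ln c).
Proof. by case/andP=> c0 c1; rewrite oppr_ge0 mulr_ge0_le0// ln_le0. Qed.

Lemma entropy_term_le1 (c : R) : 0 <= c -> - (c * ln c) <= 1.
Proof.
rewrite le_eqVlt => /predU1P[<-|c0]; first by rewrite mul0r oppr0.
rewrite -mulrN -lnV ?posrE// -(mulfV (lt0r_neq0 c0)) ler_pM2l//.
by apply/ltW/ln_sublinear; rewrite invr_gt0.
Qed.

Lemma entropy_le_support (c : nat -> R) (N : nat) :
  (forall i, 0 <= c i <= 1) -> (forall i, (N <= i)%N -> c i = 0) ->
  (entropy c <= (N%:R : R)%:E)%E.
Proof.
move=> c01 cN; rewrite /entropy (nneseries_split _ N); last first.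
  by move=> i _; rewrite lee_fin entropy_term_ge0.
rewrite add0n eseries0 ?adde0; last by move=> i Ni _; rewrite cN// mul0r oppr0.
rewrite big_mkord sumEFin lee_fin.
have -> : N%:R = \sum_(i < N) (1 : R) by rewrite sumr_const card_ord.
by apply: ler_sum => i _; apply: entropy_term_le1; case/andP: (c01 i).
Qed.

End entropy.

(* [compact_cover] is stated for pointed topological spaces only. *)
HB.instance Definition _ (G : topologicalZmodType) := Topological.on (gpt G).

Section topological_group.
Context {G : topologicalZmodType}.
Local Notation GB := (Borel G).

Definition small_set (U A : set G) : Prop :=
  forall x y, A x -> A y -> U (x - y).

Definition measurable_partition (N : nat) (A : nat -> set GB) : Prop :=
  [/\ forall i, measurable (A i), trivIset setT A, \bigcup_i A i = setT &
      forall i, (N <= i)%N -> A i = set0].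

Lemma measurable_open (U : set G) : open U -> measurable (U : set GB).
Proof. by move=> oU; apply: sub_sigma_algebra. Qed.

Lemma measurable_compact (K : set G) :
  hausdorff_space G -> compact K -> measurable (K : set GB).
Proof.
move=> hG cK; rewrite -[K]setCK; apply: measurableC; apply: measurable_open.
by rewrite openC; exact: compact_closed.
Qed.

Lemma continuous_addr (a : G) : continuous (fun x : G => x + a).
Proof.
move=> x; apply: (@continuous_comp _ _ _ (fun y => (y, a))
  (fun p : G * G => p.1 + p.2)); last exact: add_continuous.
by apply: cvg_pair => /=; [exact: cvg_id|exact: cvg_cst].
Qed.

Lemma measurable_addr (a : G) :
  measurable_fun [set: GB] (fun x : GB => (x + a : G) : GB).
Proof.
apply: (@measurability _ _ GB GB setT _ (@open G : set (set GB)) erefl).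
move=> _ [B oB <-]; rewrite setTI; apply: measurable_open.
by apply: open_comp => // x _; exact: continuous_addr.
Qed.

Lemma small_open_nbhs0 (U : set G) : nbhs 0 U ->
  exists2 V : set G, open_nbhs 0 V & small_set U V.
Proof.
move=> nU; have : nbhs (0 : G, 0 : G) ((fun p : G * G => p.1 - p.2) @^-1` U).
  by apply: (@sub_continuous G); rewrite /= subr0.
case=> -[P Q] /= [nP nQ] PQ_U.
have : nbhs 0 (P `&` Q) by exact: filterI.
rewrite nbhsE => -[V oV VPQ]; exists V => // x y /VPQ[Px _] /VPQ[_ Qy].
exact: (PQ_U (x, y)).
Qed.

Lemma small_measurable_partition (U : set G) :
  compact [set: G] -> nbhs 0 U ->
  exists (N : nat) (A : nat -> set GB),
    measurable_partition N A /\ forall i, small_set U (A i).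
Proof.
move=> cG /small_open_nbhs0[V [oV V0] smallV].
pose shift (a : gpt G) : set (gpt G) := [set x | V ((x : G) - (a : G))].
have oshift (a : gpt G) : open (shift a).
  apply: (@open_comp G G (fun x : G => x - a)) => // x _.
  exact: continuous_addr.
have : @compact (gpt G) setT by [].
rewrite compact_cover => /(_ (gpt G) setT shift (fun a _ => oshift a)) [].
  by move=> x _; exists x => //; rewrite /shift /= subrr.
move=> centers _ covered; pose s := finmap.enum_fset centers.
pose F i : set GB := if (i < size s)%N then shift (nth 0 s i) else set0.
exists (size s), (seqDU F); split; first split.
- apply: seqDU_measurable => i; rewrite /F; case: ifP => // _.
  exact: measurable_open.
- exact: trivIset_seqDU.
- rewrite -seqDU_bigcup_eq; apply/seteqP; split => // y _.
  have [a a_s Vya] : exists2 a, a \in s & shift a y by exact: covered.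
  by exists (index a s) => //; rewrite /F index_mem a_s nth_index.
- move=> i si; apply/seteqP; split => // y Ay; have := subset_seqDU Ay.
  by rewrite /F ltnNge si.
- move=> i x y Ax Ay; have := subset_seqDU Ay; have := subset_seqDU Ax.
  rewrite /F; case: ifP => // _ Vx Vy.
  by have := smallV _ _ Vx Vy; rewrite opprB addrA subrK.
Qed.

Lemma disjoint_compacts_separated (I : choiceType) (D : set I)
    (K : I -> set G) :
  hausdorff_space G -> finite_set D -> (forall i, D i -> compact (K i)) ->
  trivIset D K ->
  exists2 U : set G, nbhs 0 U & forall i j x y,
    D i -> D j -> K i x -> K j y -> U (x - y) -> i = j.
Proof.
move=> hG finD cK tK.
pose offdiag := [set p : I * I | [/\ D p.1, D p.2 & p.1 != p.2]].
pose diff (p : I * I) := (fun q : G * G => q.1 - q.2) @` (K p.1 `*` K p.2).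
exists (~` \bigcup_(p in offdiag) diff p).
  apply: open_nbhs_nbhs; split.
    rewrite openC; apply: closed_bigcup => [|p [Dp1 Dp2 _]].
      by apply: (sub_finite_set _ (finite_setX finD finD)) => p [].
    apply: compact_closed => //; apply: continuous_compact.
      exact/continuous_subspaceT/sub_continuous.
    by apply: compact_setX; exact: cK.
  move=> [[i j] [Di Dj /= /eqP ij] [[x y] [/= Kx Ky] /subr0_eq /= xy]].
  by apply: ij; apply: tK => //; exists x; split => //; rewrite xy.
move=> i j x y Di Dj Kx Ky ndiff; apply: contrapT => /eqP ij.
by apply: ndiff; exists (i, j) => //; exists (x, y).
Qed.

End topological_group.

Section compact_inner_regularity.
Context {R : realType} {G : topologicalZmodType}.
Local Notation GB := (Borel G).
Implicit Types m : probability GB R.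

Definition compact_inner_regular m : Prop :=
  forall A : set GB, measurable A ->
    m A = ereal_sup [set m (K : set GB) | K in
                       [set K : set G | compact K /\ K `<=` A]].

Lemma compact_approx m (A : set GB) (e : R) :
  compact_inner_regular m -> measurable A -> 0 < e ->
  exists K : set G, [/\ compact K, K `<=` A & (m A <= m (K : set GB) + e%:E)%E].
Proof.
move=> reg mA e0.
have fin_sup : m A \is a fin_num by exact: fin_num_measure.
rewrite (reg _ mA) in fin_sup.
have [_ [K [cK KA] <-]] := ub_ereal_sup_adherent e0 fin_sup.
by rewrite -reg// lteBlDr// => /ltW; exists K.
Qed.

Lemma disjoint_compacts_approx m (A : nat -> set GB) (J : nat) (e : R) :
  hausdorff_space G -> compact_inner_regular m ->
  (forall j, measurable (A j)) -> trivIset setT A -> 0 < e ->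
  exists K : nat -> set G,
    [/\ forall j, compact (K j), trivIset setT K, forall j, K j `<=` A j &
        (m (\bigcup_(j < J) A j)
           <= m (\bigcup_(j < J) (K j : set GB)) + e%:E)%E].
Proof.
move=> hG reg mA tA e0; pose d := e / J.+1%:R.
have d0 : 0 < d by rewrite divr_gt0 ?ltr0n.
have [K approxK] := choice (fun j => compact_approx reg (mA j) d0).
have cK j : compact (K j) by have [] := approxK j.
have KA j : K j `<=` A j by have [] := approxK j.
have tK : trivIset setT K.
  by move=> i j _ _ [x [Ki Kj]]; apply: tA => //; exists x; split; exact: KA.
exists K; split => //.
have mK j : measurable (K j : set GB) by exact: measurable_compact.
rewrite !bigcup_mkord !measure_bigsetU//.
apply: (@le_trans _ _ (\sum_(j < J) (m (K j : set GB) + d%:E))%E).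
  by apply: lee_sum => j _; have [] := approxK j.
rewrite big_split/= leeD2l// sumEFin lee_fin sumr_const card_ord -mulr_natr.
by rewrite mulrAC ler_pdivrMr ?ltr0n// ler_wpM2l ?ler_nat// ltW.
Qed.

Lemma measurable_cover_lebesgue_nbhs m (B : nat -> set GB) (e : R) :
  hausdorff_space G -> compact_inner_regular m ->
  (forall j, measurable (B j)) -> m (\bigcup_j B j) = 1%E -> 0 < e ->
  exists (U : set G) (P : set GB),
    [/\ nbhs 0 U, measurable P, (m (~` P) <= e%:E)%E &
        forall x y : G, P x -> P y -> U (x - y) -> exists j, B j x /\ B j y].
Proof.
move=> hG reg mB mUB e0; have e20 : 0 < e / 2 by rewrite divr_gt0.
have mD := seqDU_measurable mB.
have [J le_J] := measure_bigcup_approx m mD e20.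
have [K [cK tK KD le_K]] :=
  disjoint_compacts_approx J hG reg mD (trivIset_seqDU B) e20.
have [U nU sepU] :=
  disjoint_compacts_separated hG (finite_II J) (fun j _ => cK j)
  (sub_trivIset (@subsetT _ _) tK).
have mP : measurable (\bigcup_(j < J) (K j : set GB)).
  by apply: bigcup_measurable => j _; exact: measurable_compact.
exists U, (\bigcup_(j < J) K j); split => //.
  rewrite probability_setC// leeBlDr ?fin_num_measure// addeC.
  rewrite -mUB seqDU_bigcup_eq; apply: le_trans le_J _.
  rewrite [e in leRHS]splitr EFinD addeA.
  by rewrite leeD2r.
move=> x y [i iJ Kix] [j jJ Kjy] Uxy.
have ij := sepU _ _ _ _ iJ jJ Kix Kjy Uxy; subst j.
by exists i; split; apply: subset_seqDU; exact: KD.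
Qed.

End compact_inner_regularity.

Section near_diagonal.
Context {R : realType} {G : topologicalZmodType}.
Local Notation GB := (Borel G).
Implicit Types (m : probability GB R) (rho theta : G -> G -> R).

Definition near_diag_bound (X U : set G) (e : R) (u : G -> R) theta : Prop :=
  forall x y, X x -> X y -> U (x - y) -> theta x y <= e + u x + u y.

Lemma admissible_integrable_dist m rho (X : set GB) : admissible_on m rho X ->
  exists2 x0 : GB, X x0 & m.-integrable setT (fun y => (rho x0 y)%:E).
Proof.
case=> -[mX mX1 mrho _ irho] _.
have X_gt0 : (0 < m X)%E by rewrite mX1 lte01.
apply: (ae_exists mX X_gt0).
apply: (@ae_integrable1 _ _ _ _ _ m m (fun p : GB * GB => (rho p.1 p.2)%:E)).
by apply/integrable12ltyP => //; exact/measurable_EFinP.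
Qed.

Lemma admissible_close_up_to_small_measure m rho (X : set GB) (e eta : R) :
  hausdorff_space G -> compact_inner_regular m -> admissible_on m rho X ->
  0 < e -> 0 < eta ->
  exists (U : set G) (P : set GB),
    [/\ nbhs 0 U, measurable P, (m (~` P) <= eta%:E)%E &
        forall x y : G, X x -> X y -> P x -> P y -> U (x - y) -> rho x y <= e].
Proof.
move=> hG reg [[mX mX1 _ [_ [rhoC rho_tri]] _] sep] e0 eta0.
have [[d [Xd dense]] mballs _] := sep.
have e20 : 0 < e / 2 by rewrite divr_gt0.
pose B j : set GB := [set y | X y /\ rho (d j) y < e / 2].
have mB j : measurable (B j) by apply: mballs; exists (d j), (e / 2).
have XB : X `<=` \bigcup_j B j.
  move=> x Xx; have [j dj] := dense x Xx _ e20.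
  by exists j => //; split => //; rewrite rhoC.
have mUB : m (\bigcup_j B j) = 1%E.
  have mB' : measurable (\bigcup_j B j) by exact: bigcup_measurable.
  by apply/eqP; rewrite eq_le probability_le1//= -mX1 le_measure ?inE.
have [U [P [nU mP smallP shared]]] :=
  measurable_cover_lebesgue_nbhs hG reg mB mUB eta0.
exists U, P; split => // x y Xx Xy Px Py Uxy.
have [j [[_ dx] [_ dy]]] := shared x y Px Py Uxy.
by have := rho_tri x (d j) y Xx (Xd j) Xy; rewrite (rhoC x (d j))//; lra.
Qed.

(* If x or y lies outside P, the triangle inequality through x0 gives
     rho x y <= (C + excess x) + (C + excess y),
   and the point outside P carries both constants. *)
Definition base_point_bound rho (x0 : G) (P : set G) (C : R) (x : G) : R :=
  2 * C * \1_(~` P) x + excess (rho x0) C x.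

Lemma base_point_bound_ge0 rho x0 (P : set G) (C : R) x :
  0 <= C -> 0 <= base_point_bound rho x0 P C x.
Proof. by move=> C0; rewrite addr_ge0 ?mulr_ge0// excess_ge0. Qed.

Lemma near_diag_bound_base_point rho (X U P : set G) (x0 : G) (C e : R) :
  is_metric_on X rho -> X x0 -> 0 <= C -> 0 <= e ->
  (forall x y, X x -> X y -> P x -> P y -> U (x - y) -> rho x y <= e) ->
  near_diag_bound X U e (base_point_bound rho x0 P C) rho.
Proof.
move=> [_ [rhoC rho_tri]] Xx0 C0 e0 closeP x y Xx Xy Uxy.
have through_x0 :
    rho x y <= 2 * C + excess (rho x0) C x + excess (rho x0) C y.
  have := rho_tri x x0 y Xx Xx0 Xy; rewrite (rhoC x x0)//.
  by have := le_excess (rho x0) C x; have := le_excess (rho x0) C y; lra.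
have out_ge0 z : 0 <= 2 * C * \1_(~` P) z by rewrite !mulr_ge0.
have out z : ~ P z -> 2 * C * \1_(~` P) z = 2 * C.
  by move=> nPz; rewrite indicE mem_set// mulr1.
rewrite /base_point_bound; have := out_ge0 x; have := out_ge0 y.
have [Px|/out ->] := pselect (P x); last by lra.
have [Py|/out ->] := pselect (P y); last by lra.
have := closeP x y Xx Xy Px Py Uxy.
by have := excess_ge0 (rho x0) C x; have := excess_ge0 (rho x0) C y; lra.
Qed.

Lemma admissible_near_diag_bound m rho (X : set GB) (e : R) :
  hausdorff_space G -> compact_inner_regular m -> admissible_on m rho X ->
  0 < e ->
  exists (U : set G) (u : G -> R),
    [/\ nbhs 0 U, measurable_fun [set: GB] (u : GB -> R), forall x, 0 <= u x,
        (\int[m]_x (u x)%:E <= e%:E)%E & near_diag_bound X U e u rho].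
Proof.
move=> hG reg adm e0; have e20 : 0 < e / 2 by rewrite divr_gt0.
have [[_ _ _ rho_metric _] _] := adm.
have [x0 Xx0 int_dist] := admissible_integrable_dist adm.
have [C C0 small_excess] := integral_excess_small int_dist e20.
have C2_ge0 : 0 <= 2 * C by rewrite mulr_ge0.
have eta0 : 0 < e / 2 / (2 * C + 1) by rewrite divr_gt0// ltr_wpDl.
have [U [P [nU mP smallP closeP]]] :=
  admissible_close_up_to_small_measure hG reg adm e0 eta0.
have /measurable_EFinP mdist := measurable_int _ int_dist.
have mexcess : measurable_fun [set: GB] (excess (rho x0 : GB -> R) C).
  exact: measurable_excess.
have mindic : measurable_fun [set: GB] (\1_(~` P) : GB -> R).
  by apply: measurable_indic; exact: measurableC.
have mout : measurable_fun [set: GB] (fun x => 2 * C * (\1_(~` P) x : R)).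
  exact: measurable_funM.
have int_out : (\int[m]_x (2 * C * \1_(~` P) x)%:E <= (e / 2)%:E)%E.
  under eq_integral do rewrite EFinM.
  rewrite ge0_integralZl_EFin//; last exact/measurable_EFinP.
  rewrite integral_indic ?setIT//; last exact: measurableC.
  apply: le_trans (lee_wpmul2l _ smallP) _; first by rewrite lee_fin.
  rewrite -EFinM lee_fin mulrA ler_pdivrMr ?ltr_wpDl// mulrC.
  by rewrite ler_wpM2l ?(ltW e20)// lerDl.
exists U, (base_point_bound rho x0 P C); split => //.
- exact: measurable_funD.
- by move=> x; exact: base_point_bound_ge0.
- under eq_integral do rewrite EFinD.
  rewrite ge0_integralD//; [|by move=> x _; rewrite lee_fin mulr_ge0
    |exact/measurable_EFinP|by move=> x _; rewrite lee_fin excess_ge0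
    |exact/measurable_EFinP].
  by rewrite [e]splitr EFinD leeD.
- exact: near_diag_bound_base_point rho_metric Xx0 C0 (ltW e0) closeP.
Qed.

End near_diagonal.

Definition jointly_measurable {R : realType} {G : topologicalZmodType}
    (theta : G -> G -> R) : Prop :=
  measurable_fun [set: Borel G * Borel G]
    (fun p : Borel G * Borel G => theta p.1 p.2).

Section transport.
Context {R : realType} {G : topologicalZmodType}.
Local Notation GB := (Borel G).
Variable m : probability GB R.

Lemma kantorovich_le_transport (nu : set G -> \bar R) (s : GB -> GB)
    (theta : G -> G -> R) (h : G -> R) :
  measurable_fun setT s ->
  (forall B : set GB, measurable B -> nu B = m (s @^-1` B)) ->
  jointly_measurable theta ->
  measurable_fun [set: GB] (h : GB -> R) -> (forall y, 0 <= h y) ->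
  {ae m, forall y, theta (s y) y <= h y} ->
  (kantorovich theta nu m <= \int[m]_y (h y)%:E)%E.
Proof.
move=> ms nuE mtheta mh h0 theta_le; pose graph (y : GB) : GB * GB := (s y, y).
have mgraph : measurable_fun setT graph by exact: measurable_fun_pair.
pose graph_mfun : {mfun GB >-> (GB * GB)%type} := mfun_Sub (mem_set mgraph).
pose cost (p : GB * GB) : \bar R := (theta p.1 p.2)%:E.
have mcost : measurable_fun setT cost by exact/measurable_EFinP.
apply: (@le_trans _ _ (\int[distribution m graph_mfun]_p cost p)%E).
  apply: ereal_inf_lbound; exists (distribution m graph_mfun) => // B mB.
  rewrite (nuE B mB) /distribution /pushforward.
  by split; congr (m _); apply/seteqP; split => y //= [].
rewrite integralE.
apply: (@le_trans _ _ (\int[distribution m graph_mfun]_p cost^\+ p)%E).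
  by rewrite geeDl// oppe_le0; apply: integral_ge0 => p _; exact: funeneg_ge0.
rewrite ge0_integral_distribution//; last exact: measurable_funepos.
apply: ae_ge0_le_integral => //.
- by move=> y _; exact: funepos_ge0.
- exact: (measurableT_comp (measurable_funepos mcost) mgraph).
- by move=> y _; rewrite lee_fin.
- exact/measurable_EFinP.
- apply: filterS theta_le => y le_y _.
  by rewrite /= funeposE ge_max !lee_fin le_y h0.
Qed.

Definition cell_map (A : nat -> set GB) (x : nat -> G) (y : GB) : GB :=
  x (xget 0%N [set i | A i y]).

Definition cell_weight (A : nat -> set GB) (i : nat) : R := fine (m (A i)).

Section cells.
Variables (N : nat) (A : nat -> set GB) (x : nat -> G).
Hypothesis partA : measurable_partition N A.

Let mA i : measurable (A i). Proof. by case: partA. Qed.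
Let tA : trivIset setT A. Proof. by case: partA. Qed.
Let coverA y : exists i, A i y.
Proof.
case: partA => _ _ AT _; have : [set: GB] y by [].
by rewrite -AT => -[i]; exists i.
Qed.

Lemma cell_mapE i y : A i y -> cell_map A x y = x i.
Proof.
move=> Aiy; rewrite /cell_map; congr x; apply: tA => //.
by exists y; split => //; apply: (@xgetPex _ 0%N [set i | A i y]); exists i.
Qed.

Lemma preimage_cell_map (B : set GB) :
  cell_map A x @^-1` B = \bigcup_(i in x @^-1` B) A i.
Proof.
apply/seteqP; split => [y /= By|y [i /= Bxi Aiy]].
  by have [i Aiy] := coverA y; exists i => //; rewrite /= -(cell_mapE Aiy).
by rewrite /= (cell_mapE Aiy).
Qed.

Lemma measurable_cell_map : measurable_fun setT (cell_map A x).
Proof.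
by move=> _ B mB; rewrite setTI preimage_cell_map; exact: bigcup_measurable.
Qed.

Lemma cell_weightE i : (cell_weight A i)%:E = m (A i).
Proof. by rewrite fineK ?fin_num_measure. Qed.

Lemma discrete_meas_cell_map (B : set GB) :
  discrete_meas x (cell_weight A) B = m (cell_map A x @^-1` B).
Proof.
rewrite preimage_cell_map measure_bigcup//; last exact: sub_trivIset tA.
rewrite eseries_mkcond; apply: eq_eseriesr => i _.
rewrite cell_weightE indicE -[x i \in B]/(i \in x @^-1` B).
by case: ifP => _; rewrite ?mule1 ?mule0.
Qed.

Lemma sum_cell_weight : (\sum_(0 <= i <oo) (cell_weight A i)%:E = 1)%E.
Proof.
case: partA => _ _ AT _; rewrite -(probability_setT m) -AT.
rewrite measure_semi_bigcup//; last exact: bigcup_measurable.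
by apply: eq_eseriesr => i _; exact: cell_weightE.
Qed.

Lemma cell_weight_ge0_le1 i : 0 <= cell_weight A i <= 1.
Proof. by rewrite -!lee_fin cell_weightE measure_ge0 probability_le1. Qed.

Lemma entropy_cell_weight_le : (entropy (cell_weight A) <= (N%:R : R)%:E)%E.
Proof.
apply: entropy_le_support cell_weight_ge0_le1 _ => i Ni.
by case: partA => _ _ _ A0; rewrite /cell_weight A0// measure0.
Qed.

Hypothesis xA : forall i, (0 < m (A i))%E -> A i (x i).

Lemma discrete_prob_cells : discrete_prob x (cell_weight A).
Proof.
split; first by move=> i; case/andP: (cell_weight_ge0_le1 i).
split; first exact: sum_cell_weight.
move=> i j; rewrite -!lte_fin !cell_weightE => /xA Axi /xA Axj xij.
by apply: tA => //; exists (x i); split; rewrite // xij.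
Qed.

Lemma eps_entropy_le_cells (theta : G -> G -> R) (h : G -> R) (eps : R) :
  jointly_measurable theta ->
  measurable_fun [set: GB] (h : GB -> R) -> (forall y, 0 <= h y) ->
  {ae m, forall y, theta (cell_map A x y) y <= h y} ->
  (\int[m]_y (h y)%:E < eps%:E)%E ->
  (eps_entropy theta eps m <= (N%:R : R)%:E)%E.
Proof.
move=> mtheta mh h0 theta_le int_h; apply: le_trans entropy_cell_weight_le.
apply: ereal_inf_lbound; exists (cell_weight A) => //; exists x.
split; first exact: discrete_prob_cells.
split; first exact: le_lt_trans entropy_cell_weight_le (ltry _).
apply: le_lt_trans int_h.
apply: (@kantorovich_le_transport _ (cell_map A x)) => //.
- exact: measurable_cell_map.
- by move=> B _; exact: discrete_meas_cell_map.
Qed.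

End cells.

Lemma eps_entropy_le_near_diag (N : nat) (A : nat -> set GB) (Q : set GB)
    (U : set G) (u : G -> R) (theta : G -> G -> R) (e eps : R) :
  measurable_partition N A -> (forall i, small_set U (A i)) ->
  {ae m, forall y, Q y} -> jointly_measurable theta ->
  measurable_fun [set: GB] (u : GB -> R) -> (forall y, 0 <= u y) ->
  0 < e -> near_diag_bound Q U e u theta ->
  (2%:E * (e%:E + \int[m]_y (u y)%:E) < eps%:E)%E ->
  (eps_entropy theta eps m <= (N%:R : R)%:E)%E.
Proof.
move=> partA smallA aeQ mtheta mu u0 e0 bound lt_eps.
have [mA _ coverA _] := partA.
have lb_u : has_lbound (range u) by exists 0 => _ [y _ <-].
have [x xP] := almost_minimizers (T := GB) (fun i => A i `&` Q) lb_u e0.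
have xA i : (0 < m (A i))%E -> A i (x i).
  move=> Ai_gt0; have [y Ay Qy] := ae_exists (mA i) Ai_gt0 aeQ.
  by have [[]] := xP i (ex_intro _ y (conj Ay Qy)).
pose h y := 2 * (e + u y).
have meu : measurable_fun [set: GB] (fun y => e + u y).
  exact: measurable_funD.
apply: (@eps_entropy_le_cells N A x partA xA theta h) => //.
- exact: measurable_funM.
- by move=> y; rewrite mulr_ge0// addr_ge0// ltW.
- apply: filterS aeQ => y Qy.
  have [i _ Aiy] : (\bigcup_i A i) y by rewrite coverA.
  rewrite (cell_mapE x partA Aiy).
  have [[Ax Qx] ux] := xP i (ex_intro _ y (conj Aiy Qy)).
  have := bound _ _ Qx Qy (smallA _ _ _ Ax Aiy).
  by have := ux y (conj Aiy Qy); rewrite /h; lra.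
- apply: le_lt_trans lt_eps; rewrite /h; under eq_integral do rewrite EFinM.
  rewrite ge0_integralZl_EFin//; [|by move=> y _; rewrite lee_fin addr_ge0// ltW
    |exact/measurable_EFinP].
  under eq_integral do rewrite EFinD.
  rewrite ge0_integralD//; [|by move=> y _; rewrite lee_fin ltW
    |by move=> y _; rewrite lee_fin|exact/measurable_EFinP].
  by rewrite integral_cst// [X in (_ * X + _)%E]probability_setT mule1.
Qed.

End transport.

Section averages.
Context {R : realType} {G : topologicalZmodType}.
Local Notation GB := (Borel G).
Implicit Types (m : probability GB R) (g : G) (u : G -> R) (rho : G -> G -> R).

Definition translation_invariant m : Prop :=
  forall (a : G) (A : set GB), measurable A ->
    m ((fun x : G => x + a) @` A) = m A.

Definition orbit_average g u (n : nat) (x : G) : R :=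
  n%:R^-1 * \sum_(k < n) u (iter k (transl g) x).

Definition invariant_core g (X : set G) : set G :=
  [set x | forall k, X (iter k (transl g) x)].

Lemma measure_preimage_addr m (a : G) (A : set GB) :
  translation_invariant m -> measurable A ->
  m ((fun x : G => x + a) @^-1` A) = m A.
Proof.
move=> inv mA; rewrite -(inv (- a) _ mA); congr (m _).
apply/seteqP; split => [x /= Ax|_ [x Ax <-] /=]; last by rewrite subrK.
by exists (x + a) => //; rewrite addrK.
Qed.

Lemma integral_addr m (a : G) u :
  translation_invariant m -> measurable_fun [set: GB] (u : GB -> R) ->
  (forall x, 0 <= u x) ->
  (\int[m]_x (u (x + a))%:E = \int[m]_x (u x)%:E)%E.
Proof.
move=> inv mu u0.
have mEu : measurable_fun [set: GB] (EFin \o (u : GB -> R)).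
  exact/measurable_EFinP.
have := @ge0_integral_pushforward _ _ _ _ _ _
  (measurable_addr a) m setT (EFin \o u) measurableT mEu.
rewrite preimage_setT => <-; last by move=> y _; rewrite lee_fin.
apply: eq_measure_integral; first exact: measurable_addr.
by move=> ? A mA _; exact: measure_preimage_addr.
Qed.

Lemma iter_transl g (k : nat) (x : G) : iter k (transl g) x = x + g *+ k.
Proof.
elim: k => [|k IH]; first by rewrite mulr0n addr0.
by rewrite iterS IH /transl mulrSr addrA.
Qed.

Lemma measurable_iter_transl g k :
  measurable_fun [set: GB] (fun x : GB => iter k (transl g) x : GB).
Proof.
rewrite (_ : (fun x => _) = (fun x : GB => (x : G) + g *+ k : GB)).
  exact: measurable_addr.
by apply/funext => x; rewrite iter_transl.
Qed.

Lemma orbit_average_ge0 g u n x :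
  (forall y, 0 <= u y) -> 0 <= orbit_average g u n x.
Proof. by move=> u0; rewrite mulr_ge0 ?invr_ge0// sumr_ge0. Qed.

Lemma measurable_orbit_average g u n :
  measurable_fun [set: GB] (u : GB -> R) ->
  measurable_fun [set: GB] (orbit_average g u n : GB -> R).
Proof.
move=> mu; apply: measurable_funM => //; apply: measurable_sum => k.
exact: (measurableT_comp mu (measurable_iter_transl g k)).
Qed.

Lemma jointly_measurable_rho_hat g rho n :
  jointly_measurable rho -> jointly_measurable (rho_hat g rho n).
Proof.
move=> mrho; apply: measurable_funM => //; apply: measurable_sum => k.
apply: (measurableT_comp mrho (g := fun p : GB * GB =>
  (iter k (transl g) p.1 : GB, iter k (transl g) p.2 : GB))).
apply: measurable_fun_pair.
- exact: (measurableT_comp (measurable_iter_transl g k) measurable_fst).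
- exact: (measurableT_comp (measurable_iter_transl g k) measurable_snd).
Qed.

Lemma integral_orbit_average m g u n :
  translation_invariant m -> measurable_fun [set: GB] (u : GB -> R) ->
  (forall x, 0 <= u x) -> (0 < n)%N ->
  (\int[m]_x (orbit_average g u n x)%:E = \int[m]_x (u x)%:E)%E.
Proof.
move=> inv mu u0 n0.
have mk k :
    measurable_fun [set: GB] (fun x : GB => (u (iter k (transl g) x))%:E).
  apply/measurable_EFinP.
  exact: (measurableT_comp mu (measurable_iter_transl g k)).
rewrite /orbit_average; under eq_integral do rewrite EFinM -sumEFin.
rewrite ge0_integralZl//; first last.
- by move=> x _; apply: sume_ge0 => k _; rewrite lee_fin.
- exact: emeasurable_sum.
rewrite ge0_integral_sum//; last by move=> k x _; rewrite lee_fin.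
rewrite (eq_bigr (fun=> (\int[m]_x (u x)%:E)%E)); last first.
  move=> k _; rewrite -(integral_addr (g *+ k) inv mu u0).
  by apply: eq_integral => x _; rewrite iter_transl.
rewrite sumr_const card_ord -[X in (_ * X)%E]mule_natl muleA -EFinM.
by rewrite mulVf ?mul1e// pnatr_eq0 -lt0n.
Qed.

Lemma ae_invariant_core m g (X : set GB) :
  translation_invariant m -> measurable X -> m X = 1%E ->
  {ae m, forall x, invariant_core g X x}.
Proof.
move=> inv mX mX1; apply: ae_foralln => k.
pose P : set GB := (fun x : G => x + g *+ k) @^-1` X.
have mP : measurable P by rewrite -[P]setTI; exact: measurable_addr.
have P0 : m (~` P) = 0%E.
  by rewrite probability_setC// measure_preimage_addr// mX1 subee.
exists (~` P); split; [exact: measurableC|exact: P0|].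
by move=> x /=; rewrite iter_transl.
Qed.

Lemma near_diag_bound_rho_hat g rho (X U : set G) (e : R) u n : (0 < n)%N ->
  near_diag_bound X U e u rho ->
  near_diag_bound (invariant_core g X) U e (orbit_average g u n)
    (rho_hat g rho n).
Proof.
move=> n0 bound x y coreXx coreXy Uxy.
have nR0 : 0 < (n%:R : R) by rewrite ltr0n.
have -> : e = n%:R^-1 * \sum_(k < n) e.
  by rewrite sumr_const card_ord -[e *+ n]mulr_natl mulKf ?gt_eqF.
rewrite -!mulrDr ler_pM2l ?invr_gt0// -!big_split/=.
apply: ler_sum => k _; apply: bound => //.
by rewrite !iter_transl opprD addrACA subrr addr0.
Qed.

End averages.

Theorem theorem5 (R : realType) (G : topologicalZmodType)
  (m : probability (Borel G) R) (g : G) (rho : G -> G -> R) :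
  compact [set: G] -> hausdorff_space G ->
  haar m -> ergodic_translation m g ->
  (bounded_admissible m rho \/
   (admissible m rho /\
    exists rhoT : G -> G -> R, average_limit m g rho rhoT /\ admissible m rhoT)) ->
  forall eps : R, 0 < eps ->
    exists M : R, forall n : nat, (0 < n)%N ->
      (eps_entropy (rho_hat g rho n) eps m <= M%:E)%E.
Proof.
move=> cG hG [inv reg] _ rho_adm eps eps0.
have [X admX] : admissible m rho.
  by case: rho_adm => [[X [C [admX _]]]|[]//]; exists X.
have [[mX mX1 mrho _ _] _] := admX.
pose e := eps / 5; have e0 : 0 < e by rewrite divr_gt0.
have [U [u [nU mu u0 int_u bound]]] :=
  admissible_near_diag_bound hG reg admX e0.
have [N [A [partA smallA]]] := small_measurable_partition cG nU.
exists N%:R => n n0.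
apply: (eps_entropy_le_near_diag partA smallA (ae_invariant_core g inv mX mX1)
  (jointly_measurable_rho_hat g n mrho) (measurable_orbit_average g n mu) _ e0
  (near_diag_bound_rho_hat n0 bound)).
  by move=> y; exact: orbit_average_ge0.
rewrite integral_orbit_average//.
apply: (@le_lt_trans _ _ (2%:E * (e%:E + e%:E))%E).
  by rewrite lee_wpmul2l// leeD2l.
by rewrite -EFinD -EFinM lte_fin /e; lra.
Qed.
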